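(* Let $a\in\mathbb{Z}^n$ be a row vector with positive components whose greatest common divisor is $1$, let $v\in\mathbb{R}^n$ be a column vector with $v\ge0$, let $\beta_1,\beta_2$ be integers with $0\le\beta_1\le\beta_2\le av$, and let $$Q=\{\,x\in\mathbb{R}^n\mid\beta_1\le ax\le\beta_2,\ 0\le x\le v\,\}.$$ Suppose that $a=\lambda p+r$, where $p\in\mathbb{Z}^n$ is an integral row vector with $p\ge0$, $\lambda\in\mathbb{Q}$ with $\lambda>0$, and $r\in\mathbb{Q}^n$. Then $$\mathrm{iwidth}(p,Q)\ \le\ \left\lfloor\frac{\|r\|\,\|v\|}{\lambda}+\frac{\beta_2-\beta_1}{\lambda}\right\rfloor+1 .$$
   Context: $\|\cdot\|$ is the Euclidean norm, and vector inequalities are componentwise. For a polyhedron $Q$ and an integral row vector $c$, the integer width of $Q$ along $c$ is $$\mathrm{iwidth}(c,Q)=\lfloor\max\{cx\mid x\in Q\}\rfloor-\lceil\min\{cx\mid x\in Q\}\rceil+1 .$$ $Q$ is the feasible set of the LP-relaxation of the knapsack feasibility problem $\beta_1\le ax\le\beta_2,\ 0\le x\le v,\ x\in\mathbb{Z}^n$. *)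

(* Defs.v *)
(* The reals are an arbitrary [R : realType]. *)
From HB Require Import structures.
From mathcomp Require Export all_boot all_order all_algebra.
From mathcomp Require Export all_classical all_reals.

Set Implicit Arguments.
Unset Strict Implicit.
Unset Printing Implicit Defensive.

Import Order.TTheory GRing.Theory Num.Theory.
Local Open Scope classical_set_scope.
Local Open Scope ring_scope.

(* The library's norm on matrices is the sup norm, hence this definition; it is
   stated for all shapes so as to cover both row and column vectors. *)
Definition enorm (R : realType) (m n : nat) (x : 'M[R]_(m, n)) : R :=
  Num.sqrt (\sum_(i < m) \sum_(j < n) x i j ^+ 2).

(* [c *m x] as a number, for an integral row [c] and a real column [x]. *)
Definition zdot (R : realType) (n : nat) (c : 'rV[int]_n) (x : 'cV[R]_n) : R :=
  (map_mx intr c *m x) 0 0.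

(* Attained extrema; the value is 0 when the extremum does not exist. *)
Definition setmax (R : realType) (A : set R) : R := xget 0 (A `&` ubound A).
Definition setmin (R : realType) (A : set R) : R := xget 0 (A `&` lbound A).

Definition iwidth (R : realType) (n : nat) (c : 'rV[int]_n)
    (Q : set 'cV[R]_n) : int :=
  Num.floor (setmax (zdot c @` Q)) - Num.ceil (setmin (zdot c @` Q)) + 1.

Definition knapsack_relaxation (R : realType) (n : nat) (a : 'rV[int]_n)
    (v : 'cV[R]_n) (beta1 beta2 : int) : set 'cV[R]_n :=
  [set x | beta1%:~R <= zdot a x <= beta2%:~R /\
           forall i, 0 <= x i 0 <= v i 0].

(* Main.v *)
(* Let x and y be a maximizer and a minimizer of p over the compact set Q.
   Since a = lambda p + r,
     lambda p(x - y) = a(x - y) - r(x - y) <= (beta2 - beta1) + ||r|| ||x - y||,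
   and ||x - y|| <= ||v|| because both points lie in the box [0, v].  Finally
   floor(px) - ceil(py) is an integer which is at most p(x - y). *)
Require Import Defs.
From mathcomp Require Import ring lra.
From mathcomp Require Import topology normedtype derive.
Set Implicit Arguments.
Unset Strict Implicit.
Unset Printing Implicit Defensive.
Import Order.TTheory GRing.Theory Num.Theory.
Import numFieldNormedType.Exports.
Local Open Scope classical_set_scope.
Local Open Scope ring_scope.

(** Cauchy-Schwarz. With [S], [T], [P] as set below, [T u - P w] is [T] times the component of [u]
    orthogonal to [w], and the sum of its squared entries is [T (T S - P^2)], which is therefore
    nonnegative. *)
Lemma ler_sum_mul_sqrt (R : rcfType) (I : finType) (u w : I -> R) :
  \sum_i u i * w i <=
  Num.sqrt (\sum_i u i ^+ 2) * Num.sqrt (\sum_i w i ^+ 2).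
Proof.
set S := \sum_i u i ^+ 2; set T := \sum_i w i ^+ 2; set P := \sum_i u i * w i.
have S_ge0 : 0 <= S by apply: sumr_ge0 => i _; exact: sqr_ge0.
have T_ge0 : 0 <= T by apply: sumr_ge0 => i _; exact: sqr_ge0.
have TP : 0 <= T * (T * S - P ^+ 2).
  have -> : T * (T * S - P ^+ 2) = \sum_i (T * u i - P * w i) ^+ 2.
    rewrite (eq_bigr (fun i => T ^+ 2 * u i ^+ 2 - 2 * T * P * (u i * w i)
                               + P ^+ 2 * w i ^+ 2)); last by move=> i _; ring.
    rewrite big_split/= sumrB -!mulr_sumr -/S -/T -/P; ring.
  by apply: sumr_ge0 => i _; exact: sqr_ge0.
have PP : P ^+ 2 <= S * T.
  have [T_gt0|] := ltP 0 T.
    by move: TP; rewrite pmulr_rge0// subr_ge0 mulrC.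
  (* For [T = 0] the inequality [TP] carries no information, but then [w] vanishes and [P] with
     it. *)
  move=> T_le0; have /eqP T0 : T == 0 by rewrite eq_le T_le0.
  have w0 i : w i = 0.
    move/eqP: T0; rewrite psumr_eq0 => [/allP/(_ i)|j _]; last exact: sqr_ge0.
    by rewrite mem_index_enum sqrf_eq0 => /(_ isT)/eqP.
  by rewrite T0 mulr0 /P big1 ?expr0n// => i _; rewrite w0 mulr0.
by rewrite -sqrtrM// (le_trans (ler_norm P))// -sqrtr_sqr ler_wsqrtr.
Qed.

Lemma zdotE (R : realType) n (c : 'rV[int]_n) (x : 'cV[R]_n) :
  zdot c x = \sum_j (c 0 j)%:~R * x j 0.
Proof. by rewrite /zdot mxE; apply: eq_bigr => j _; rewrite mxE. Qed.

Lemma zdotZ (R : realType) n (c : 'rV[int]_n) (t : R) (x : 'cV[R]_n) :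
  zdot c (t *: x) = t * zdot c x.
Proof. by rewrite /zdot -scalemxAr mxE. Qed.

Lemma zdotB (R : realType) n (c : 'rV[int]_n) (x y : 'cV[R]_n) :
  zdot c (x - y) = zdot c x - zdot c y.
Proof. by rewrite /zdot mulmxBr !mxE. Qed.

Lemma mulmx_le_enorm (R : realType) n (u : 'rV[R]_n) (x : 'cV[R]_n) :
  (u *m x) 0 0 <= enorm u * enorm x.
Proof.
(* In the double sum of [enorm], the outer index is trivial for the row [u] and the inner one for
   the column [x]. *)
rewrite mxE (le_trans (ler_sum_mul_sqrt _ _))// /enorm big_ord1.
by rewrite [X in _ <= _ * Num.sqrt X](eq_bigr (fun i => x i 0 ^+ 2))//
  => i _; rewrite big_ord1.
Qed.

Lemma enormN (R : realType) m n (x : 'M[R]_(m, n)) : enorm (- x) = enorm x.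
Proof.
congr Num.sqrt; apply: eq_bigr => i _; apply: eq_bigr => j _.
by rewrite mxE sqrrN.
Qed.

Lemma le_enorm (R : realType) m n (x y : 'M[R]_(m, n)) :
  (forall i j, `|x i j| <= y i j) -> enorm x <= enorm y.
Proof.
move=> xy; apply: ler_wsqrtr; apply: ler_sum => i _; apply: ler_sum => j _.
(* Squaring is monotone only on nonnegative numbers; that [y i j] is one follows from its bounding
   an absolute value. *)
by rewrite -[leLHS]real_normK ?num_real// lerXn2r// ?nnegrE// (le_trans _ (xy i j)).
Qed.

(** The extreme value theorem for the identity map yields a greatest element, so [xget] chooses from
    an inhabited set and does not fall back on its default. *)
Lemma setmax_mem (R : realType) (A : set R) :
  A !=set0 -> compact A -> A (setmax A).
Proof.
move=> A0 Aco.
have [|c /[!inE] Ac cmax] := @compact_EVT_max _ R id A A0 Aco.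
  by apply: continuous_subspaceT => x; exact: cvg_id.
have Pc : (A `&` ubound A) c by split=> // t At; apply: cmax; rewrite inE.
by have [] := xgetI 0 Pc.
Qed.

Lemma setmin_mem (R : realType) (A : set R) :
  A !=set0 -> compact A -> A (setmin A).
Proof.
move=> A0 Aco.
have [|c /[!inE] Ac cmin] := @compact_EVT_min _ R id A A0 Aco.
  by apply: continuous_subspaceT => x; exact: cvg_id.
have Pc : (A `&` lbound A) c by split=> // t At; apply: cmin; rewrite inE.
by have [] := xgetI 0 Pc.
Qed.

(* The transpose is there because [rV_compact] is about row vectors only. *)
Lemma zdot_tr_continuous (R : realType) n (c : 'rV[int]_n) :
  continuous (fun w : 'rV[R]_n => zdot c w^T).
Proof.
rewrite (_ : (fun w => _) = (fun w : 'rV[R]_n => \sum_j (c 0 j)%:~R * w 0 j)).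
  apply: (@continuous_big _ _ _ _ xpredT
    (@pseudometric_normed_Zmodule.add_continuous _ R^o)) => j _ w.
  apply: (@continuousM R _ (fun=> _) (fun w : 'rV[R]_n => w 0 j) w).
    exact: cst_continuous.
  exact: coord_continuous.
by apply/funext => w; rewrite zdotE; apply: eq_bigr => j _; rewrite mxE.
Qed.

(** Up to transposition, the polyhedron is a box [B], compact as a product of segments, cut by [H],
    the closed preimage of a segment under the continuous form [a]. Its image under the continuous
    form [c] is then compact. *)
Lemma zdot_knapsack_compact (R : realType) n (c a : 'rV[int]_n) (v : 'cV[R]_n)
    (beta1 beta2 : int) :
  compact (zdot c @` knapsack_relaxation a v beta1 beta2).
Proof.
pose B := [set w : 'rV[R]_n | forall i, `[0, v i 0]%classic (w ord0 i)].
pose H := (fun w : 'rV[R]_n => zdot a w^T) @^-1` `[beta1%:~R, beta2%:~R].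
have -> : zdot c @` knapsack_relaxation a v beta1 beta2
          = (fun w : 'rV[R]_n => zdot c w^T) @` (B `&` H).
  apply/seteqP; split=> [_ [x [ax xv] <-]|_ [x [Bx Hx] <-]].
    exists x^T; last by rewrite trmxK.
    split=> [i|]; first by rewrite /= in_itv mxE; exact: xv.
    by rewrite /H /= trmxK in_itv.
  exists x^T => //; split.
    by move: Hx; rewrite /H/= in_itv.
  by move=> i; have := Bx i; rewrite /= in_itv mxE.
apply: continuous_compact.
  exact: (continuous_subspaceT (@zdot_tr_continuous R n c)).
apply: compact_closedI.
  apply: (rV_compact (A := fun i => `[0, v i 0]%classic)) => i.
  exact: segment_compact.
have /continuous_closedP := @zdot_tr_continuous R n a; apply.
exact: itv_closed.
Qed.

(** The witness is [v] scaled so that [a] takes the value [beta2] on it; since [beta2 <= a v], the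
    factor is at most 1 and the point stays in the box. *)
Lemma knapsack_relaxation_nonempty (R : realType) n (a : 'rV[int]_n)
    (v : 'cV[R]_n) (beta1 beta2 : int) :
  (forall i, 0 <= v i 0) -> 0 <= beta1 -> beta1 <= beta2 ->
  beta2%:~R <= zdot a v -> knapsack_relaxation a v beta1 beta2 !=set0.
Proof.
move=> v_ge0 b1 b12 b2av.
have b2 : 0 <= beta2%:~R :> R by rewrite ler0z (le_trans b1).
have av : 0 <= zdot a v := le_trans b2 b2av.
(* If a v = 0 then beta2 = 0, and t = 0 because division by 0 gives 0. *)
pose t := beta2%:~R / zdot a v.
have t_ge0 : 0 <= t by rewrite divr_ge0.
have t_le1 : t <= 1.
  have [av0|av0] := eqVneq (zdot a v) 0; first by rewrite /t av0 invr0 mulr0.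
  by rewrite ler_pdivrMr ?mul1r// lt0r av0.
have atv : t * zdot a v = beta2%:~R.
  have [av0|av0] := eqVneq (zdot a v) 0; last by rewrite divfK.
  by rewrite av0 mulr0; apply/esym/eqP; rewrite eq_le b2 -av0 b2av.
exists (t *: v); split=> [|i].
  by rewrite zdotZ atv lexx ler_int b12.
by rewrite mxE mulr_ge0//= ler_piMl.
Qed.

(** The rational identity is carried to [R] entrywise by the ring morphism [ratr]. *)
Lemma zdot_decomp (R : realType) n (a p : 'rV[int]_n) (lambda : rat)
    (r : 'rV[rat]_n) (x : 'cV[R]_n) :
  map_mx intr a = lambda *: map_mx intr p + r ->
  zdot a x = ratr lambda * zdot p x + ((map_mx ratr r : 'rV[R]_n) *m x) 0 0.
Proof.
move=> a_decomp.
have aE : (map_mx intr a : 'rV[R]_n)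
          = ratr lambda *: map_mx intr p + map_mx ratr r.
  apply/rowP => j; have /rowP/(_ j) := a_decomp.
  rewrite !mxE => /(congr1 (@ratr R)).
  by rewrite rmorphD rmorphM/= !ratr_int.
by rewrite /zdot aE mulmxDl -scalemxAl !mxE.
Qed.

Lemma zdot_knapsack_diff_le (R : realType) n (a : 'rV[int]_n) (v : 'cV[R]_n)
    (beta1 beta2 : int) (p : 'rV[int]_n) (lambda : rat) (r : 'rV[rat]_n)
    (x y : 'cV[R]_n) :
  0 < lambda -> map_mx intr a = lambda *: map_mx intr p + r ->
  knapsack_relaxation a v beta1 beta2 x ->
  knapsack_relaxation a v beta1 beta2 y ->
  zdot p x - zdot p y <=
  enorm (map_mx ratr r : 'rV[R]_n) * enorm v / ratr lambda
  + (beta2 - beta1)%:~R / ratr lambda.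
Proof.
move=> lambda_gt0 a_decomp [/andP[_ ax] xv] [/andP[ay _] yv].
have l0 : 0 < ratr lambda :> R by rewrite ltr0q.
rewrite -mulrDl ler_pdivlMr// mulrC -zdotB.
have yxv : enorm (y - x) <= enorm v.
  apply: le_enorm => i j; rewrite ord1 !mxE.
  have /andP[? ?] := xv i; have /andP[? ?] := yv i.
  by rewrite ler_norml; lra.
(* Cauchy-Schwarz is applied to [y - x] rather than [x - y], because it is [- r (x - y)] that needs
   an upper bound. *)
have := mulmx_le_enorm (map_mx ratr r) (y - x).
have := zdot_decomp (y - x) a_decomp.
have -> : y - x = - (x - y) by rewrite opprB.
rewrite enormN -[- (x - y)]scaleN1r !zdotZ !mulN1r zdotB => E rxy.
have := ler_wpM2l (sqrtr_ge0 _ : 0 <= enorm (map_mx ratr r : 'rV[R]_n)) yxv.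
rewrite -opprB enormN rmorphB/=; lra.
Qed.

Theorem theorem5 (R : realType) (n : nat) (a : 'rV[int]_n) (v : 'cV[R]_n)
    (beta1 beta2 : int) (p : 'rV[int]_n) (lambda : rat) (r : 'rV[rat]_n)
    (a_gt0 : forall j, 0 < a 0 j)
    (gcd_a : \big[gcdn/0%N]_(j < n) `|a 0%R j|%N = 1%N)
    (v_ge0 : forall i, 0 <= v i 0)
    (beta1_ge0 : 0 <= beta1)
    (le_beta12 : beta1 <= beta2)
    (le_beta2_av : beta2%:~R <= zdot a v)
    (p_ge0 : forall j, 0 <= p 0 j)
    (lambda_gt0 : 0 < lambda)
    (a_decomp : map_mx intr a = lambda *: map_mx intr p + r) :
  iwidth p (knapsack_relaxation a v beta1 beta2) <=
  Num.floor (enorm (map_mx ratr r : 'rV[R]_n) * enorm v / ratr lambda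
             + (beta2 - beta1)%:~R / ratr lambda) + 1.
Proof.
have A0 : zdot p @` knapsack_relaxation a v beta1 beta2 !=set0.
  apply: image_nonempty.
  exact: knapsack_relaxation_nonempty le_beta2_av.
have Aco := @zdot_knapsack_compact R n p a v beta1 beta2.
have [x Qx px] := setmax_mem A0 Aco.
have [y Qy py] := setmin_mem A0 Aco.
(* The two [+ 1] cancel. What remains on the left is an integer, so it is below the floor as soon as
   it is below the real number itself. *)
rewrite /iwidth -px -py lerD2r floor_ge_int rmorphB/=.
apply: le_trans (zdot_knapsack_diff_le lambda_gt0 a_decomp Qx Qy).
by rewrite lerB// ?floor_le// ceil_ge.
Qed.
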